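(* Let $q$ be a complex number with $|q|<1$, and let $x,y$ be nonzero complex numbers such that $xq^k\neq 1$ and $yq^k\neq 1$ for all integers $k\geq 1$. Then \[ \sum_{i,j\in\mathbb{Z}} \frac{x^i y^j q^{i^2-ij+j^2}}{(xq;q)_i\,(yq;q)_j} = \frac{(q;q)_\infty\,(-xyq,\,-q/(xy),\,q^2;q^2)_\infty}{(xq,\,yq;q)_\infty}. \]
   Context: The $q$-shifted factorials are defined by $(a;q)_0=1$, $(a;q)_n=\prod_{k=0}^{n-1}(1-aq^k)$ for $n\geq 1$, $(a;q)_\infty=\prod_{k=0}^{\infty}(1-aq^k)$, and for negative subscripts $(a;q)_{-n}=1/(aq^{-n};q)_n$ for $n\geq1$ (so $1/(a;q)_{-n}=(aq^{-n};q)_n$). Products are abbreviated as $(a_1,\dots,a_m;q)_k=(a_1;q)_k\cdots(a_m;q)_k$ for $k\in\mathbb{Z}\cup\{\infty\}$. *)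

(* Defs.v *)
(* complex numbers are `R[i]` (real-closed `complex`) over
   an abstract `R : realType`; R[i] is a numClosedFieldType, hence a
   numFieldType with its canonical normed/topological structure. *)
From HB Require Import structures.
From mathcomp Require Import all_boot all_order all_algebra.
From mathcomp Require Import all_classical all_reals all_analysis.
From mathcomp Require Export complex.
Set Implicit Arguments. Unset Strict Implicit. Unset Printing Implicit Defensive.
Import Order.TTheory GRing.Theory Num.Theory.
Import numFieldNormedType.Exports.
Local Open Scope ring_scope.
Local Open Scope complex_scope.

Section QPoch.
Variable C : numFieldType.

Definition qpoch (a q : C) (n : nat) : C := \prod_(k < n) (1 - a * q ^+ k).

Definition qpochZ (a q : C) (n : int) : C :=
  match n with
  | Posz m => qpoch a q m
  | Negz m => (qpoch (a * q ^- m.+1) q m.+1)^-1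
  end.

Definition qpoch_inf (a q : C) : C := limn (fun n => qpoch a q n).

Definition term1p1 (x y q : C) (i j : int) : C :=
  x ^ i * y ^ j * q ^ (i * i - i * j + j * j) / (qpochZ (x * q) q i * qpochZ (y * q) q j).

Definition sqsum (f : int -> int -> C) (N : nat) : C :=
  \sum_(k < (2 * N).+1) \sum_(l < (2 * N).+1) f (k%:Z - N%:Z) (l%:Z - N%:Z).
End QPoch.

(* Main.v *)
Require Import Defs.
From HB Require Import structures.
From mathcomp Require Import all_boot all_order all_algebra.
From mathcomp Require Import all_classical all_reals all_analysis.
From mathcomp Require Import complex.
From mathcomp Require Import finmap.
From mathcomp Require Import ring lra zify.
Import Order.TTheory GRing.Theory Num.Theory.
Import numFieldNormedType.Exports.
Local Open Scope ring_scope.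
Local Open Scope complex_scope.
Local Open Scope classical_set_scope.
Set Implicit Arguments.
Unset Strict Implicit.
Unset Printing Implicit Defensive.

(* Multiplied by (xq, yq; q)_oo, the (i, j) term becomes
     x^i y^j q^(i^2 - ij + j^2) (x q^(i+1), y q^(j+1); q)_oo.
   Expand both infinite products by Euler's series, with indices k and l, and
   reindex the resulting absolutely convergent fourfold sum by a = i + k and
   b = j + l.  The coefficient of x^a y^b is q^(a^2 - ab + b^2) times a sum over
   (k, l) depending only on d = b - a; summing it over l first produces the
   factor (q^(1-k-d); q)_oo, which vanishes for k + d >= 1, so that by the
   symmetry (k, l, d) -> (l, k, -d) the coefficient is (q; q)_oo for d = 0 and 0
   otherwise.  What remains is the theta series sum_n (xy)^n q^(n^2), evaluated
   by the Jacobi triple product, which is proved in the same way. *)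

(** * Unconditional summation *)

Section UnconditionalSums.
Variable C : numFieldType.
Implicit Types T U : choiceType.

(** Convergence along the net of finite subsets ordered by inclusion. No enumeration is chosen, so
    sums over [nat], [int] and their products can be reindexed freely. *)
Definition has_sum T (f : T -> C) (s : C) :=
  forall e : C, 0 < e -> exists A : {fset T}, forall B : {fset T},
    (A `<=` B)%fset -> `|s - \sum_(t <- B) f t| < e.

(** Stated as a bound on finite sums, without naming a limit, so that it makes sense before any
    completeness is available. *)
Definition abs_summable T (f : T -> C) :=
  exists M : C, forall A : {fset T}, \sum_(t <- A) `|f t| <= M.

Lemma eq_has_sum T (f g : T -> C) s : g =1 f -> has_sum f s -> has_sum g s.
Proof. by move=> /funext ->. Qed.

Lemma has_sum_unique T (f : T -> C) s t : has_sum f s -> has_sum f t -> s = t.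
Proof.
move=> fs ft; apply/eqP; rewrite -subr_eq0 -normr_eq0; apply/negPn/negP => ne.
have e0 : 0 < `|s - t| / 2 by rewrite divr_gt0 // lt_def ne normr_ge0.
have [A hA] := fs _ e0; have [B hB] := ft _ e0.
have h1 := hA _ (fsubsetUl A B); have h2 := hB _ (fsubsetUr A B).
set S := \sum_(_ <- _) _ in h1 h2.
have := ler_normB (s - S) (t - S).
rewrite (_ : s - S - (t - S) = s - t); last by ring.
move=> /le_lt_trans/(_ (ltrD h1 h2)).
by rewrite -splitr ltxx.
Qed.

Lemma has_sumD T (f g : T -> C) s t :
  has_sum f s -> has_sum g t -> has_sum (fun x => f x + g x) (s + t).
Proof.
move=> fs gt e e0; have e20 : 0 < e / 2 by rewrite divr_gt0.
have [A hA] := fs _ e20; have [B hB] := gt _ e20.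
exists (A `|` B)%fset => D; rewrite fsubUset => /andP[/hA h1 /hB h2].
rewrite big_split /= opprD addrACA (splitr e).
exact: le_lt_trans (ler_normD _ _) (ltrD h1 h2).
Qed.

Lemma has_sumZ T (f : T -> C) s c : has_sum f s -> has_sum (fun x => c * f x) (c * s).
Proof.
move=> fs e e0.
have c0 : 0 < `|c| + 1 by rewrite ltr_wpDl.
have [A hA] := fs _ (divr_gt0 e0 c0).
exists A => B /hA h; rewrite -mulr_sumr -mulrBr normrM.
apply: (@le_lt_trans _ _ ((`|c| + 1) * `|s - \sum_(t <- B) f t|)).
  by rewrite ler_wpM2r // lerDl.
by rewrite mulrC -ltr_pdivlMr.
Qed.

Lemma has_sumB T (f g : T -> C) s t :
  has_sum f s -> has_sum g t -> has_sum (fun x => f x - g x) (s - t).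
Proof.
move=> fs /(has_sumZ (-1)) gt; rewrite -mulN1r.
by apply: eq_has_sum (has_sumD fs gt) => x; rewrite mulN1r.
Qed.

(** If B contains the image of A, the terms of B that can be nonzero are the image of a finite set
    containing A. Serves both for bijective reindexing and for discarding indices where f
    vanishes. *)
Lemma has_sum_emb T U (phi : U -> T) (psi : T -> U) (f : T -> C) s :
  cancel phi psi -> (forall t, phi (psi t) != t -> f t = 0) ->
  has_sum (f \o phi) s -> has_sum f s.
Proof.
move=> phiK f0 fs e /fs[A hA].
exists (phi @` A)%fset => B AB.
pose D := [fset psi t | t in [fset t in B | phi (psi t) == t]]%fset.
have pinj : {in [fset t in B | phi (psi t) == t]%fset &, injective psi}.
  move=> x y; rewrite !inE => /andP[_ /eqP xE] /andP[_ /eqP yE] h.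
  by rewrite -xE h yE.
have -> : \sum_(t <- B) f t = \sum_(u <- D) (f \o phi) u.
  rewrite big_imfset //= (big_fsetID _ (fun t => phi (psi t) == t)) /=.
  rewrite [X in _ + X]big1_seq ?addr0; last first.
    by move=> t /= ; rewrite !inE /= => /andP[_ /f0].
  by apply: eq_big_seq => t; rewrite !inE => /andP[_ /eqP ->].
apply: hA; apply/fsubsetP => u uA.
apply/imfsetP; exists (phi u) => //=.
by rewrite !inE /= phiK eqxx andbT; apply: (fsubsetP AB); rewrite in_imfset.
Qed.

Lemma has_sum_single T (t0 : T) (f : T -> C) :
  (forall t, t != t0 -> f t = 0) -> has_sum f (f t0).
Proof.
move=> f0 e e0; exists [fset t0]%fset => B; rewrite fsub1set => tB.
rewrite (big_fsetD1 t0) //= big1_seq ?addr0 ?subrr ?normr0 //.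
by move=> t /=; rewrite !inE => /andP[/f0].
Qed.

Lemma has_sum_norm_le T (f : T -> C) s M :
  has_sum f s -> (forall A : {fset T}, \sum_(t <- A) `|f t| <= M) -> `|s| <= M.
Proof.
move=> fs fM; apply/ler_addgt0Pl => e /fs[A /(_ A (fsubset_refl A)) h].
rewrite -[s](subrK (\sum_(t <- A) f t)).
apply: le_trans (ler_normD _ _) _; apply: lerD; first exact: ltW.
exact: le_trans (ler_norm_sum _ _ _) (fM A).
Qed.

(** A single finite set of columns approximates all rows over B at once: the union of the sets
    obtained row by row. *)
Lemma has_sum_unif T U (f : T * U -> C) g (B : {fset T}) e :
  (forall t, has_sum (fun u => f (t, u)) (g t)) -> 0 < e ->
  exists W0 : {fset U}, forall W : {fset U}, (W0 `<=` W)%fset ->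
    \sum_(t <- B) `|g t - \sum_(u <- W) f (t, u)| <= e.
Proof.
(* The error is shared among the rows of B; the successor keeps the divisor nonzero when B is
   empty. *)
move=> fg e0; pose e' := e / #|` B|.+1%:R.
have e'0 : 0 < e' by rewrite divr_gt0.
have /boolp.choice[D hD] : forall t, exists A : {fset U}, forall W : {fset U},
    (A `<=` W)%fset -> `|g t - \sum_(u <- W) f (t, u)| < e'.
  by move=> t; apply: fg.
exists (\bigcup_(t <- B) D t)%fset => W hW.
apply: (@le_trans _ _ (\sum_(t <- B) e')).
  rewrite big_seq_cond [X in _ <= X]big_seq_cond; apply: ler_sum => t.
  rewrite andbT => tB; apply/ltW/hD/(fsubset_trans _ hW).
  exact: (@bigfcup_sup _ _ _ _ (fun=> true) D).
rewrite big_const_seq count_predT iter_addr_0 -[leLHS]mulr_natr /e' mulrAC.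
by rewrite ler_pdivrMr // ler_pM2l // ler_nat leqnSn.
Qed.

Lemma sum_fsetX T U (f : T * U -> C) (B : {fset T}) (W : {fset U}) :
  \sum_(p <- (B `*` W)%fset) f p = \sum_(t <- B) \sum_(u <- W) f (t, u).
Proof. by rewrite big_imfset2 //= => -[? ?] [? ?] _ _ /= [-> ->]. Qed.

(** Choose W to contain the second coordinates of A and to be fine enough for the rows of B. The
    rectangle B x W then contains A, so its sum is close both to s and to the sum of g over B. *)
Lemma has_sum_fubini T U (f : T * U -> C) g s :
  has_sum f s -> (forall t, has_sum (fun u => f (t, u)) (g t)) -> has_sum g s.
Proof.
move=> fs fg e e0; have e20 : 0 < e / 2 by rewrite divr_gt0.
have [A hA] := fs _ e20.
exists [fset p.1 | p in A]%fset => B AB.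
have [W0 hW] := has_sum_unif B fg e20.
pose W := (W0 `|` [fset p.2 | p in A])%fset.
have {}hW := hW W (fsubsetUl _ _).
have {}hA : `|s - \sum_(p <- (B `*` W)%fset) f p| < e / 2.
  apply: hA; apply/fsubsetP => p pA; rewrite in_fsetM.
  rewrite (fsubsetP AB) ?in_imfset //=.
  by rewrite inE in_imfset ?orbT.
rewrite -(subrK (\sum_(p <- (B `*` W)%fset) f p) s) -addrA (splitr e).
apply: le_lt_trans (ler_normD _ _) (ltr_leD hA _).
rewrite sum_fsetX -sumrB -normrN -sumrN.
apply: le_trans (ler_norm_sum _ _ _) _.
by rewrite (eq_bigr (fun t => `|g t - \sum_(u <- W) f (t, u)|)) // => t _; rewrite opprB.
Qed.

(** On finitely many rows, g is within a total error e of sums over a finite rectangle, where the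
    bound for f applies; e is arbitrary. *)
Lemma summable_fubini T U (f : T * U -> C) g :
  abs_summable f -> (forall t, has_sum (fun u => f (t, u)) (g t)) -> abs_summable g.
Proof.
move=> [M hM] fg; exists M => A; apply/ler_addgt0Pl => e e0.
have [W /(_ _ (fsubset_refl _)) hW] := has_sum_unif A fg e0.
apply: (@le_trans _ _ (\sum_(t <- A)
    (`|g t - \sum_(u <- W) f (t, u)| + \sum_(u <- W) `|f (t, u)|))).
  apply: ler_sum => t _; rewrite -{1}[g t](subrK (\sum_(u <- W) f (t, u))).
  apply: le_trans (ler_normD _ _) _; rewrite lerD2l.
  exact: ler_norm_sum.
rewrite big_split /= lerD //.
by have := hM (A `*` W)%fset; rewrite (sum_fsetX (fun p => `|f p|)).
Qed.

Lemma summable_le T (f g : T -> C) K : 0 <= K ->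
  (forall t, `|f t| <= K * `|g t|) -> abs_summable g -> abs_summable f.
Proof.
move=> K0 fg [M hM]; exists (K * M) => A.
apply: (@le_trans _ _ (\sum_(t <- A) K * `|g t|)); first exact: ler_sum.
by rewrite -mulr_sumr ler_wpM2l.
Qed.

Lemma summable_comp T U (phi : U -> T) (f : T -> C) :
  injective phi -> abs_summable f -> abs_summable (f \o phi).
Proof.
move=> phiI [M hM]; exists M => A.
have := hM (phi @` A)%fset.
by rewrite big_imfset //= => x y _ _; apply: phiI.
Qed.

Lemma sum_fset_le T (f : T -> C) (A B : {fset T}) : (forall t, 0 <= f t) ->
  (A `<=` B)%fset -> \sum_(t <- A) f t <= \sum_(t <- B) f t.
Proof.
move=> f0 AB; rewrite [leRHS](big_fsetID _ (mem A)) /=.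
rewrite [X in X + _](_ : _ = \sum_(t <- A) f t) ?lerDl ?sumr_ge0 //.
apply: eq_fbigl => t; rewrite !inE /= andbC.
by case: (boolP (t \in A)) => // /(fsubsetP AB) ->.
Qed.

(** A finite set of pairs lies in the rectangle of its projections, where the sum of norms
    factors. *)
Lemma summable_prod T U (f : T -> C) (g : U -> C) :
  abs_summable f -> abs_summable g -> abs_summable (fun p => f p.1 * g p.2).
Proof.
move=> [M hM] [N hN]; exists (M * N) => A.
pose A1 := [fset p.1 | p in A]%fset; pose A2 := [fset p.2 | p in A]%fset.
apply: (@le_trans _ _ (\sum_(p <- (A1 `*` A2)%fset) `|f p.1 * g p.2|)).
  apply: sum_fset_le => //; apply/fsubsetP => p pA.
  by rewrite in_fsetM !in_imfset.
rewrite (sum_fsetX (fun p => `|f p.1 * g p.2|)) /=.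
under eq_bigr do under eq_bigr do rewrite normrM.
under eq_bigr do rewrite -mulr_sumr.
rewrite -mulr_suml; apply: ler_pM => //; exact: sumr_ge0.
Qed.

End UnconditionalSums.

(** * Geometric series over the naturals and the integers *)

Lemma summable_nat (C : numFieldType) (f : nat -> C) (M : C) :
  (forall n, \sum_(k < n) `|f k| <= M) -> abs_summable f.
Proof.
move=> fM; exists M => A; pose n := (\max_(k <- A) k).+1.
apply: le_trans (fM n); rewrite -(big_mkord xpredT (fun k => `|f k|)) /index_iota subn0.
apply: (@le_trans _ _ (\sum_(k <- [fset k in iota 0 n]%fset) `|f k|)).
  apply: sum_fset_le => //; apply/fsubsetP => k kA.
  have kn : k \in iota 0 n by rewrite mem_iota ltnS (@leq_bigmax_seq _ _ xpredT id).
  by apply/imfsetP; exists k.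
rewrite (perm_big (iota 0 n)) //; apply: uniq_perm => [||k]; rewrite ?fset_uniq ?iota_uniq //.
by apply/imfsetP/idP => [[j jn ->]|kn] //; exists k.
Qed.

Lemma summable_geometric (C : numFieldType) (q : C) :
  `|q| < 1 -> abs_summable (fun n => q ^+ n).
Proof.
move=> q1; apply: (@summable_nat _ _ (1 - `|q|)^-1) => n.
have d0 : 0 < 1 - `|q| by rewrite subr_gt0.
rewrite -[leRHS]mul1r ler_pdivlMr //.
under eq_bigr do rewrite normrX.
by rewrite mulrC -opprB mulNr -subrX1 opprB gerBl exprn_ge0.
Qed.

Lemma summable_geometric_int (C : numFieldType) (q : C) : `|q| < 1 ->
  abs_summable (fun a : int => q ^+ `|a|%N).
Proof.
move=> q1; have S := summable_geometric q1.
(* The two half-lines of the integers go injectively to the two axes of [nat * nat], where the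
   product of two geometric series is q^|a|. *)
pose phi (a : int) := if 0 <= a then (`|a|%N, 0%N) else (0%N, `|a|%N).
have phiI : injective phi.
  by move=> a b; rewrite /phi; case: ifP => ha; case: ifP => hb [] *; lia.
have [M hM] := summable_comp phiI (summable_prod S S).
exists M => A; apply: le_trans (hM A); apply: ler_sum => a _ /=.
by rewrite /phi; case: ifP => _; rewrite /= expr0 ?mulr1 ?mul1r.
Qed.

(** * Absolutely summable families of complex numbers *)

Section ComplexSums.
Variable R : realType.
Local Notation C := (complex R : numFieldType).
Implicit Types T U : choiceType.

Lemma complex_gt0E (e : C) : 0 < e -> exists2 e' : R, 0 < e' & e = e'%:C.
Proof.
move=> e0; have /complex_realP[k ke] := gtr0_real e0.
by exists k => //; rewrite -ltcR -ke.
Qed.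

Lemma complex_ge0E (e : C) : 0 <= e -> exists2 e' : R, 0 <= e' & e = e'%:C.
Proof.
move=> e0; have /complex_realP[k ke] := ger0_real e0.
by exists k => //; rewrite -lecR -ke.
Qed.

Lemma norm_real_complex (r : R) : `|(r%:C : C)| = `|r|%:C.
Proof. by rewrite normc_def /= expr0n addr0 sqrtr_sqr. Qed.

(** Completeness of the reals enters here: the sum is the supremum of the finite sums, which
    increase with the index set. *)
Lemma has_sum_nneg T (u : T -> R) M : (forall t, 0 <= u t) ->
  (forall A : {fset T}, \sum_(t <- A) u t <= M) ->
  exists s : C, has_sum (fun t => (u t)%:C : C) s.
Proof.
move=> u0 uM; pose S : set R := [set \sum_(t <- A) u t | A in [set: {fset T}]].
have hS : has_sup S.
  split; first by exists (\sum_(t <- fset0) u t); exists fset0.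
  by exists M => _ [A _ <-].
exists ((sup S)%:C) => _ /complex_gt0E[e e0 ->].
have [_ [A _ <-] hA] := sup_adherent e0 hS.
exists A => B AB; rewrite -rmorph_sum -rmorphB norm_real_complex ltcR.
have le1 := sum_fset_le u0 AB.
have le2 : \sum_(t <- B) u t <= sup S by apply: sup_ubound hS.2 _ _; exists B.
rewrite ger0_norm ?subr_ge0 //; lra.
Qed.

(** Re f = (Re f + |f|) - |f| is a difference of two nonnegative families with bounded finite
    sums. *)
Lemma has_sum_Re T (f : T -> C) : abs_summable f ->
  exists s : C, has_sum (fun t => (complex.Re (f t))%:C : C) s.
Proof.
move=> [M hM].
have M0 : 0 <= M by have := hM fset0; rewrite big_seq_fset0.
have [m m0 mE] := complex_ge0E M0.
have nE (t : T) : `|f t| = (complex.Re `|f t|)%:C by rewrite RRe_real // normr_real.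
have n0 t : 0 <= complex.Re `|f t| by rewrite -ler0c -nE.
have reN t : `|complex.Re (f t)| <= complex.Re `|f t| by rewrite -lecR -nE normc_ge_Re.
have nM (A : {fset T}) : \sum_(t <- A) complex.Re `|f t| <= m.
  by rewrite -lecR -mE rmorph_sum /=; under eq_bigr do rewrite -nE.
have [s1 h1] := has_sum_nneg n0 nM.
have [||s2 h2] := @has_sum_nneg T (fun t => complex.Re (f t) + complex.Re `|f t|) (m + m).
- by move=> t; have := reN t; rewrite ler_norml => /andP[]; lra.
- move=> A; rewrite big_split /= lerD // (le_trans _ (nM A)) //.
  by apply: ler_sum => t _; apply: le_trans (ler_norm _) (reN t).
exists (s2 - s1); apply: eq_has_sum (has_sumB h2 h1) => t.
by rewrite -rmorphB addrK.
Qed.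

(** Since Re(i f) = - Im f, one has f = Re f - i Re(i f), and real parts are already summed. *)
Lemma summable_has_sum T (f : T -> C) : abs_summable f -> exists s, has_sum f s.
Proof.
move=> Sf; have [s1 h1] := has_sum_Re Sf.
have Sg : abs_summable (fun t => 'i%C * f t : C).
  apply: (@summable_le _ _ _ f 1) Sf => // t.
  by rewrite normrM mul1r normc_def /= expr0n add0r expr1n sqrtr1 mul1r.
have [s2 h2] := has_sum_Re Sg.
exists (s1 - 'i%C * s2).
apply: eq_has_sum (has_sumB h1 (has_sumZ 'i%C h2)) => t.
have -> : complex.Re ('i%C * f t) = - complex.Im (f t) by case: (f t) => a b /=; ring.
by rewrite [LHS]complexE rmorphN mulrN opprK.
Qed.

Lemma cvgn_epsP (u : nat -> C) (l : C) :
  (forall e : C, 0 < e -> exists N : nat, forall n, (N <= n)%N -> `|l - u n| < e) ->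
  u @ \oo --> l.
Proof. by move=> H; apply/cvgrPdist_lt => e e0; have [N HN] := H e e0; exists N. Qed.

Lemma exprn_small (q e : C) : `|q| < 1 -> 0 < e ->
  exists N, forall n, (N <= n)%N -> `|q| ^+ n < e.
Proof.
have [r r0 ->] := complex_ge0E (normr_ge0 q).
move=> r1 /complex_gt0E[d d0 ->]; rewrite ltcR in r1.
have /cvgrPdist_lt/(_ d d0)[N _ hN] : r ^+ n @[n --> \oo] --> 0.
  by apply: cvg_expr; rewrite ger0_norm.
exists N => n /hN /=; rewrite -rmorphXn /= ltcR add0r normrN.
by rewrite ger0_norm // exprn_ge0.
Qed.

(* Any x^a grows at most geometrically in |a|, so it is absorbed by q^(a^2). *)
Lemma exprz_bound (q x : C) : q != 0 -> `|q| < 1 -> x != 0 ->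
  exists M : nat, forall a : int, `|x ^ a| * `|q| ^+ (M * `|a|)%N <= 1.
Proof.
move=> q0 q1 x0.
have [N1 h1] : exists N, forall n, (N <= n)%N -> `|q| ^+ n < `|x|^-1.
  by apply: exprn_small; rewrite // invr_gt0 normr_gt0.
have [N2 h2] : exists N, forall n, (N <= n)%N -> `|q| ^+ n < `|x|.
  by apply: exprn_small; rewrite // normr_gt0.
exists (maxn N1 N2) => a; rewrite exprM.
have le1 := ltW (h1 _ (leq_maxl N1 N2)); have le2 := ltW (h2 _ (leq_maxr N1 N2)).
case: a => n.
  rewrite [x ^ n](_ : _ = x ^+ n) // normrX.
  by rewrite -exprMn exprn_ile1 ?mulr_ge0 ?exprn_ge0 // mulrC -ler_pdivlMr ?normr_gt0 // mul1r.
rewrite [x ^ _](_ : _ = x ^- n.+1) // normfV normrX -exprVn -exprMn.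
rewrite exprn_ile1 ?mulr_ge0 ?exprn_ge0 ?invr_ge0 //.
by rewrite mulrC ler_pdivrMr ?normr_gt0 // mul1r.
Qed.

Lemma summable_gauss (q x : C) : q != 0 -> `|q| < 1 -> x != 0 ->
  abs_summable (fun a : int => x ^ a * q ^ (a * a)).
Proof.
move=> q0 q1 x0; have [M hM] := exprz_bound q0 q1 x0.
have nq0 : 0 < `|q| by rewrite normr_gt0.
(* With n = |a|, the inequality n^2 + (M+1)^2 >= (M+1) n leaves a factor |q|^n after |q|^(M n) has
   absorbed x^a; this dictates the constant. *)
apply: (@summable_le _ _ _ (fun a : int => q ^+ `|a|%N) (`|q| ^- (M.+1 ^ 2))).
- by rewrite invr_ge0 exprn_ge0.
- move=> a; rewrite [leRHS]mulrC ler_pdivlMr ?exprn_gt0 // normrM.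
  rewrite [q ^ _](_ : _ = q ^+ (`|a| * `|a|)%N); last first.
    by rewrite exprnP; congr (_ ^ _); lia.
  rewrite !normrX -mulrA -exprD.
  apply: (@le_trans _ _ (`|x ^ a| * `|q| ^+ (M * `|a| + `|a|))).
    rewrite ler_wpM2l // ler_wiXn2l ?ltW //; nia.
  by rewrite exprD mulrA ler_piMl // exprn_ge0.
- exact: summable_geometric_int.
Qed.

(** The squares [-N, N]^2 eventually contain any given finite set of pairs. *)
Lemma has_sum_sqsum (f : int -> int -> C) s :
  has_sum (fun p => f p.1 p.2) s -> sqsum f @ \oo --> s.
Proof.
move=> fs; apply: cvgn_epsP => e /fs[A hA].
exists (\max_(p <- A) (`|p.1| + `|p.2|)%N) => N hN.
pose B := [fset ((k : 'I_(2 * N).+1)%:Z - N%:Z) | k in 'I_(2 * N).+1]%fset.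
have memB (a : int) : (`|a| <= N)%N -> a \in B.
  move=> aN; apply/imfsetP; exists (inord (absz (a + N%:Z))) => //=.
  by rewrite inordK; lia.
have -> : sqsum f N = \sum_(p <- (B `*` B)%fset) f p.1 p.2.
  have sB (g : int -> C) : \sum_(a <- B) g a = \sum_(k < (2 * N).+1) g (k%:Z - N%:Z).
    rewrite big_imfset /=; first by rewrite big_enum.
    by move=> k l _ _ h; apply: val_inj => /=; lia.
  rewrite (sum_fsetX (fun p => f p.1 p.2)) /= sB.
  by apply: eq_bigr => k _; rewrite sB.
apply: hA; apply/fsubsetP => -[a b] abA; rewrite in_fsetM.
have := @leq_bigmax_seq _ (enum_fset A) xpredT
  (fun p : int * int => `|p.1| + `|p.2|)%N _ abA isT.
by move=> /= /leq_trans/(_ hN) h; rewrite !memB //=; lia.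
Qed.

End ComplexSums.

(** * Euler's series for q-shifted factorials *)

Section EulerSeries.
Variable R : realType.
Local Notation C := (complex R : numFieldType).
Implicit Types (a q w s t : C).

(** The coefficient of a^k in Euler's expansion of (a; q)_oo. *)
Definition euler_coef q k : C := (-1) ^+ k * q ^+ 'C(k, 2) / qpoch q q k.

Lemma qpoch0 a q : qpoch a q 0 = 1.
Proof. by rewrite /qpoch big_ord0. Qed.

Lemma qpochS a q n : qpoch a q n.+1 = qpoch a q n * (1 - a * q ^+ n).
Proof. by rewrite /qpoch big_ord_recr. Qed.

Lemma qpochSl a q n : qpoch a q n.+1 = (1 - a) * qpoch (a * q) q n.
Proof.
rewrite /qpoch big_ord_recl expr0 mulr1; congr (_ * _).
by apply: eq_bigr => k _; rewrite exprS mulrA.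
Qed.

Lemma qpoch_neq0 a q n : (forall k, a * q ^+ k != 1) -> qpoch a q n != 0.
Proof. by move=> aq; apply/prodf_neq0 => k _; rewrite subr_eq0 eq_sym. Qed.

Lemma expr_neq1 q : `|q| < 1 -> forall k, q * q ^+ k != 1.
Proof.
move=> q1 k; apply/eqP => /(congr1 Num.norm); rewrite -exprS normrX normr1.
by move/eqP; rewrite lt_eqF // exprn_ilt1.
Qed.

Lemma qpochqq_neq0 q n : `|q| < 1 -> qpoch q q n != 0.
Proof. by move=> q1; apply/qpoch_neq0/expr_neq1. Qed.

Lemma norm_qpochqq_ge q n : `|q| < 1 -> (1 - `|q|) ^+ n <= `|qpoch q q n|.
Proof.
move=> q1; have d0 : 0 <= 1 - `|q| by rewrite subr_ge0 ltW.
elim: n => [|n IH]; first by rewrite qpoch0 normr1.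
rewrite qpochS normrM exprSr ler_pM ?exprn_ge0 //.
apply: le_trans (lerB_normD _ _); rewrite normr1 lerD2l lerN2 normrN -exprS normrX.
by rewrite exprS ler_piMr // exprn_ile1 // ltW.
Qed.

(* The crude bound |(q; q)_k| >= (1 - |q|)^k suffices here thanks to the
   quadratic exponent; the uniform bound [qpochqq_inv_bounded] relies on this. *)
Lemma summable_euler q a : q != 0 -> `|q| < 1 ->
  abs_summable (fun k => euler_coef q k * a ^+ k).
Proof.
move=> q0 q1; have d0 : 0 < 1 - `|q| by rewrite subr_gt0.
have nq0 : 0 < `|q| by rewrite normr_gt0.
(* With r^2 = |q|, the equality k^2 = 2 binom(k, 2) + k turns |q|^binom(k, 2) into r^(k^2) / r^k, a
   Gaussian factor in base r. *)
pose r : C := sqrtC `|q|.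
have r0 : 0 < r by rewrite sqrtC_gt0.
have rE : r ^+ 2 = `|q| by rewrite sqrtCK.
have r1 : `|r| < 1 by rewrite gtr0_norm // -(@expr_lt1 _ 2) ?rE // ltW.
(* Chosen so that x^k r^(k^2) = ((|a| + 1) / (1 - |q|))^k |q|^binom(k, 2), which dominates the Euler
   term; the added 1 keeps x nonzero when a = 0. *)
pose x : C := (`|a| + 1) / ((1 - `|q|) * r).
have x0 : x != 0 by rewrite mulf_neq0 ?invr_neq0 ?mulf_neq0 ?gt_eqF // ltr_wpDl.
have := summable_comp (phi := Posz) (fun m n => @can_inj _ _ _ absz absz_nat m n)
  (summable_gauss (lt0r_neq0 r0) r1 x0).
apply: (@summable_le _ _ _ _ 1) => // k /=.
rewrite mul1r !normrM normfV !normrX normrN normr1 expr1n mul1r.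
have r0' := gtr0_norm r0.
have x0' : `|x| * r = (`|a| + 1) / (1 - `|q|).
  have xp : 0 < x by rewrite divr_gt0 ?mulr_gt0 // ltr_wpDl.
  rewrite (gtr0_norm xp) /x.
  by rewrite invfM mulrA mulfVK // gt_eqF.
have kk : (k * k = 2 * 'C(k, 2) + k)%N.
  by elim: (k) => // n IH; rewrite binS bin1; lia.
rewrite kk exprD exprM r0' rE mulrCA -exprMn x0' -mulrA ler_wpM2l ?exprn_ge0 //.
rewrite expr_div_n mulrC ler_pM ?exprn_ge0 ?invr_ge0 ?lerXn2r ?nnegrE ?addr_ge0 ?lerDl //.
by rewrite lef_pV2 ?posrE ?exprn_gt0 ?normr_gt0 ?qpochqq_neq0 // norm_qpochqq_ge.
Qed.

(** Writing c_k for the coefficients, c_(k+1) (1 - q^(k+1)) = - q^k c_k. Hence the series F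
    satisfies F(a) - F(aq) = - a F(aq), the constant terms cancelling. *)
Lemma euler_step q a s t : `|q| < 1 ->
  has_sum (fun k => euler_coef q k * a ^+ k) s ->
  has_sum (fun k => euler_coef q k * (a * q) ^+ k) t -> s = (1 - a) * t.
Proof.
move=> q1 hs ht; have h := has_sumB hs ht.
have h' : has_sum (fun k => euler_coef q k * a ^+ k - euler_coef q k * (a * q) ^+ k) (- a * t).
  apply: (@has_sum_emb _ _ _ succn predn) => //.
    by case=> [|k]; rewrite ?eqxx // !expr0 subrr.
  apply: eq_has_sum (has_sumZ (- a) ht) => k /=.
  have p0 := qpochqq_neq0 k q1.
  have c0 : 1 - q * q ^+ k != 0 by rewrite subr_eq0 eq_sym expr_neq1.
  rewrite /euler_coef qpochS binS bin1 !exprMn !exprS exprD.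
  by field; rewrite p0 c0.
have := has_sum_unique h h'.
by move/(canRL (subrK _)) => ->; ring.
Qed.

(** Every term with k >= 1 gains a factor of norm at most |q|^n, so the distance to the constant
    term is at most |q|^n M. *)
Lemma pseries_cvg0 (c : nat -> C) a q (S : nat -> C) : `|q| < 1 ->
  abs_summable (fun k => c k * a ^+ k) ->
  (forall n, has_sum (fun k => c k * (a * q ^+ n) ^+ k) (S n)) ->
  S @ \oo --> c 0%N.
Proof.
move=> q1 [M hM] hS.
have M0 : 0 <= M by have := hM fset0; rewrite big_seq_fset0.
have M1 : 0 < M + 1 by rewrite ltr_wpDl.
apply: cvgn_epsP => e e0.
have [N hN] := exprn_small q1 (divr_gt0 e0 M1).
exists N => n /hN; rewrite ltr_pdivlMr // => lt_e; apply: le_lt_trans lt_e.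
pose d k := if k == 0%N then c 0%N else 0.
have hd : has_sum d (c 0%N) by apply: (@has_sum_single _ _ 0%N) => -[].
apply: (@le_trans _ _ (`|q| ^+ n * M)); last by rewrite ler_wpM2l ?exprn_ge0 // lerDl.
apply: has_sum_norm_le (has_sumB hd (hS n)) _ => A.
apply: le_trans (ler_wpM2l (exprn_ge0 n (normr_ge0 q)) (hM A)).
rewrite mulr_sumr; apply: ler_sum => -[|k] _.
  by rewrite /d /= !expr0 mulr1 subrr normr0 mulr_ge0 ?exprn_ge0.
rewrite /d /= sub0r normrN exprMn mulrA normrM mulrC ler_wpM2r //.
rewrite exprS normrM -normrX ler_piMr // -exprM normrX exprn_ile1 // ltW //.
Qed.

(** Iterating the functional equation gives F(a) = (a; q)_n F(a q^n) with F(a q^n) -> F(0) = 1. Thus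
    (a; q)_n tends to F(a), which yields convergence of the product and its expansion together. *)
Lemma has_sum_qpoch_inf q a : q != 0 -> `|q| < 1 ->
  has_sum (fun k => euler_coef q k * a ^+ k) (qpoch_inf a q) /\
  qpoch a q @ \oo --> qpoch_inf a q.
Proof.
move=> q0 q1.
have /boolp.choice[S hS] : forall n, exists s,
    has_sum (fun k => euler_coef q k * (a * q ^+ n) ^+ k) s.
  by move=> n; apply/summable_has_sum/summable_euler.
have S1 : S @ \oo --> (1 : C).
  have -> : (1 : C) = euler_coef q 0 by rewrite /euler_coef qpoch0 !expr0 mul1r divr1.
  exact: pseries_cvg0 (summable_euler a q0 q1) hS.
have S0E n : S 0%N = qpoch a q n * S n.
  elim: n => [|n ->]; first by rewrite qpoch0 mul1r.
  rewrite qpochS -mulrA; congr (_ * _); apply: (euler_step q1 (hS n)).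
  by have := hS n.+1; rewrite exprSr mulrA.
have h : qpoch a q @ \oo --> S 0%N.
  have h1 : (fun n => S 0%N / S n) @ \oo --> S 0%N.
    rewrite -[X in _ --> X]divr1.
    by apply: cvgM; [exact: cvg_cst|apply: cvgV => //; exact: oner_neq0].
  apply: cvg_trans h1; apply: near_eq_cvg.
  (* Once [S n] is within distance 1 of its limit 1 it is nonzero, and the division is
     legitimate. *)
  have /cvgrPdist_lt/(_ 1 ltr01) := S1.
  apply: filterS => n hn; rewrite (S0E n) mulfK //.
  by apply: contraTneq hn => ->; rewrite subr0 normr1 ltxx.
have -> : qpoch_inf a q = S 0%N by apply: cvg_lim.
by split=> //; have := hS 0%N; rewrite expr0 mulr1.
Qed.

Lemma qpoch_infS q a : q != 0 -> `|q| < 1 ->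
  qpoch_inf a q = (1 - a) * qpoch_inf (a * q) q.
Proof.
move=> q0 q1; have [h1 _] := has_sum_qpoch_inf a q0 q1.
by have [h2 _] := has_sum_qpoch_inf (a * q) q0 q1; apply: (euler_step q1 h1 h2).
Qed.

Lemma qpoch_inf_shift q a n : q != 0 -> `|q| < 1 ->
  qpoch_inf a q = qpoch a q n * qpoch_inf (a * q ^+ n) q.
Proof.
move=> q0 q1; elim: n a => [|n IH] a; first by rewrite qpoch0 mul1r mulr1.
by rewrite (qpoch_infS a q0 q1) (IH (a * q)) qpochSl exprS !mulrA.
Qed.

(** The tail (a q^N; q)_oo tends to 1, so it is nonzero for some N; the N factors in front are
    nonzero by hypothesis. *)
Lemma qpoch_inf_neq0 q a : q != 0 -> `|q| < 1 -> (forall k, a * q ^+ k != 1) ->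
  qpoch_inf a q != 0.
Proof.
move=> q0 q1 aq.
have : (fun n => qpoch_inf (a * q ^+ n) q) @ \oo --> euler_coef q 0.
  apply: (pseries_cvg0 q1 (summable_euler a q0 q1)) => n.
  by case: (has_sum_qpoch_inf (a * q ^+ n) q0 q1).
rewrite /euler_coef qpoch0 !expr0 mul1r divr1.
move=> /cvgrPdist_lt/(_ 1 ltr01)[N _ /(_ N (leqnn N))] /= hN.
rewrite (qpoch_inf_shift _ N q0 q1) mulf_neq0 ?qpoch_neq0 //.
by apply: contraTneq hN => ->; rewrite subr0 normr1 ltxx.
Qed.

Lemma qpoch_inf_lt1_neq0 q w : q != 0 -> `|q| < 1 -> `|w| < 1 -> qpoch_inf w q != 0.
Proof.
move=> q0 q1 w1; apply: qpoch_inf_neq0 => // k.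
apply/eqP => /(congr1 Num.norm); rewrite normrM normrX normr1 => /eqP.
by rewrite lt_eqF // (le_lt_trans _ w1) // ler_piMr // exprn_ile1 // ltW.
Qed.

Lemma qpoch_inf_eq0 q n : q != 0 -> `|q| < 1 -> qpoch_inf (q ^- n) q = 0.
Proof.
move=> q0 q1; rewrite (qpoch_inf_shift _ n.+1 q0 q1) qpochS.
by rewrite mulVf ?expf_neq0 // subrr mulr0 mul0r.
Qed.

(** (q; q)_n has a nonzero limit L, so its norm eventually exceeds |L|/2; the finitely many earlier
    inverses are added to the bound. *)
Lemma qpochqq_inv_bounded q : q != 0 -> `|q| < 1 ->
  exists2 K : C, 0 <= K & forall n, `|(qpoch q q n)^-1| <= K.
Proof.
move=> q0 q1; have [_ h] := has_sum_qpoch_inf q q0 q1.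
have L0 := qpoch_inf_neq0 q0 q1 (expr_neq1 q1).
have d0 : 0 < `|qpoch_inf q q| / 2 by rewrite divr_gt0 ?normr_gt0.
have /cvgrPdist_lt/(_ _ d0)[N _ hN] := h.
exists (2 / `|qpoch_inf q q| + \sum_(n < N) `|(qpoch q q n)^-1|).
  by rewrite addr_ge0 ?divr_ge0 ?sumr_ge0.
move=> n; case: (ltnP n N) => nN.
  by rewrite (bigD1 (Ordinal nN)) //= addrCA lerDl addr_ge0 ?divr_ge0 ?sumr_ge0.
apply: (@le_trans _ _ (2 / `|qpoch_inf q q|)); last by rewrite lerDl sumr_ge0.
rewrite normfV -[2 / _]invf_div lef_pV2 ?posrE ?normr_gt0 ?qpochqq_neq0 //.
have /= /ltW lt1 := hN n nN.
have := ler_normD (qpoch_inf q q - qpoch q q n) (qpoch q q n).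
rewrite subrK => /le_trans/(_ (lerD lt1 (lexx _))).
by rewrite [leLHS]splitr lerD2l.
Qed.

(** Euler's second series G satisfies G(w) - G(wq) = w G(w), whence G(w q^n) = (w; q)_n G(w).
    Letting n grow gives 1 = (w; q)_oo G(w). *)
Lemma has_sum_qpoch_inf_inv q w : q != 0 -> `|q| < 1 -> `|w| < 1 ->
  has_sum (fun k => w ^+ k / qpoch q q k) (qpoch_inf w q)^-1.
Proof.
move=> q0 q1 w1; have [K K0 hK] := qpochqq_inv_bounded q0 q1.
pose c k := (qpoch q q k)^-1.
have Sw (v : C) : `|v| < 1 -> abs_summable (fun k => c k * v ^+ k).
  move=> v1; apply: summable_le K0 _ (summable_geometric v1) => k.
  by rewrite normrM ler_wpM2r ?hK.
have wq n : `|w * q ^+ n| < 1.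
  rewrite normrM (le_lt_trans _ w1) // ler_piMr // normrX exprn_ile1 // ltW //.
have /boolp.choice[S hS] : forall n, exists s,
    has_sum (fun k => c k * (w * q ^+ n) ^+ k) s.
  by move=> n; apply/summable_has_sum/Sw.
have S1 : S @ \oo --> c 0%N by apply: pseries_cvg0 (Sw _ w1) hS.
have step n : S n.+1 = (1 - w * q ^+ n) * S n.
  have := hS n.+1; have := hS n.
  rewrite exprSr mulrA; move: (w * q ^+ n) => v hs ht.
  have h := has_sumB hs ht.
  have h' : has_sum (fun k => c k * v ^+ k - c k * (v * q) ^+ k) (v * S n).
    apply: (@has_sum_emb _ _ _ succn predn) => //.
      by case=> [|k]; rewrite ?eqxx // !expr0 subrr.
    apply: eq_has_sum (has_sumZ v hs) => k /=.
    have p0 := qpochqq_neq0 k q1.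
    have c0 : 1 - q * q ^+ k != 0 by rewrite subr_eq0 eq_sym expr_neq1.
    rewrite /c qpochS !exprMn !exprS.
    by field; rewrite p0 c0.
  by rewrite mulrBl mul1r -(has_sum_unique h h') subKr.
have S0E n : S n = qpoch w q n * S 0%N.
  by elim: n => [|n IH]; rewrite ?qpoch0 ?mul1r // qpochS step IH mulrCA mulrA.
have : S @ \oo --> qpoch_inf w q * S 0%N.
  rewrite {1}(_ : S = fun n => qpoch w q n * S 0%N); last exact/funext.
  by apply: cvgM (cvg_cst _); case: (has_sum_qpoch_inf w q0 q1).
move=> S2; have : c 0%N = qpoch_inf w q * S 0%N by apply: (cvg_unique _ S1 S2).
rewrite /c qpoch0 invr1 => E.
have -> : (qpoch_inf w q)^-1 = S 0%N.
  have L0 : qpoch_inf w q != 0.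
    by apply/eqP => L0; move/eqP: E; rewrite L0 mul0r oner_eq0.
  by apply: (mulfI L0); rewrite -E mulfV.
have := hS 0%N; rewrite expr0 mulr1; apply: eq_has_sum => k.
by rewrite mulrC.
Qed.

(** Trades each denominator of the double sum for an infinite product that Euler's series expands.
    For negative i, dividing by [qpochZ] restores the first |i| factors of the left-hand product. *)
Lemma qpoch_inf_qpochZ q a (i : int) : q != 0 -> `|q| < 1 ->
  (forall k, a * q * q ^+ k != 1) ->
  qpoch_inf (a * q ^ (i + 1)) q = qpoch_inf (a * q) q / qpochZ (a * q) q i.
Proof.
move=> q0 q1 aq; rewrite expfzDr // expr1z [q ^ i * q]mulrC mulrA; case: i => n /=.
  by rewrite -exprnP (qpoch_inf_shift (a * q) n q0 q1) [RHS]mulrAC divff ?qpoch_neq0 // mul1r.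
rewrite invrK [RHS]mulrC (qpoch_inf_shift (a * q * q ^ Negz n) n.+1 q0 q1).
by rewrite NegzE -exprnN mulfVK // expf_neq0.
Qed.

End EulerSeries.

(** * The Jacobi triple product *)

(** Doubled and cast to integers so that exponents with binomials can be compared by integer
    arithmetic. *)
Lemma binZ (n : nat) : 2 * 'C(n, 2)%:Z = n%:Z * n%:Z - n%:Z.
Proof. by elim: n => // n IH; rewrite binS bin1; lia. Qed.

Section TripleProduct.
Variable R : realType.
Local Notation C := (complex R : numFieldType).
Implicit Types (q w z : C).

(* Since (p^(n+1); p)_oo = 0 for n < 0, the product (p, -zq; p)_oo with p = q^2
   is a bilateral sum of z^n q^(n^2) (p^(n+1); p)_oo.  Expanding the last factor
   with index l and putting c = n + l separates the double sum into the theta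
   series and sum_l w^l / (p; p)_l = 1 / (w; p)_oo, where w = - q / z. *)
Lemma triple_product_lt q z : q != 0 -> `|q| < 1 -> z != 0 -> `|q / z| < 1 ->
  has_sum (fun n : int => z ^ n * q ^ (n * n))
    (qpoch_inf (- (z * q)) (q ^+ 2) * qpoch_inf (- (q / z)) (q ^+ 2)
       * qpoch_inf (q ^+ 2) (q ^+ 2)).
Proof.
move=> q0 q1 z0 qz1; set p := q ^+ 2; set w := - (q / z).
have p0 : p != 0 by rewrite expf_neq0.
have p1 : `|p| < 1 by rewrite normrX exprn_ilt1.
have w1 : `|w| < 1 by rewrite normrN.
have [K K0 hK] := qpochqq_inv_bounded p0 p1.
pose c (cl : int * nat) : C := (z ^ cl.1 * q ^ (cl.1 * cl.1)) * (w ^+ cl.2 / qpoch p p cl.2).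
have Sc : abs_summable c.
  apply: (@summable_prod _ _ _ (fun a : int => z ^ a * q ^ (a * a))
    (fun l => w ^+ l / qpoch p p l) (summable_gauss q0 q1 z0)).
  apply: summable_le K0 _ (summable_geometric w1) => l.
  by rewrite mulrC normrM ler_wpM2r.
have [T hT] := summable_has_sum (summable_gauss q0 q1 z0).
have [s hs] := summable_has_sum Sc.
have sE : s = T * (qpoch_inf w p)^-1.
  have hc n : has_sum (fun l => c (n, l)) (z ^ n * q ^ (n * n) * (qpoch_inf w p)^-1).
    exact: has_sumZ (has_sum_qpoch_inf_inv p0 p1 w1).
  have h1 := has_sum_fubini hs hc.
  have h2 := has_sumZ (qpoch_inf w p)^-1 hT.
  by rewrite mulrC; apply: has_sum_unique h1 (eq_has_sum _ h2) => n; rewrite mulrC.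
pose f (kl : int * nat) : C :=
  z ^ kl.1 * q ^ (kl.1 * kl.1) * (euler_coef p kl.2 * (p ^ (kl.1 + 1)) ^+ kl.2).
have hf : has_sum f s.
  pose phi (cl : int * nat) := (cl.1 - cl.2%:Z, cl.2).
  pose psi (kl : int * nat) := (kl.1 + kl.2%:Z, kl.2).
  apply: (@has_sum_emb _ _ _ phi psi) => [[n l]|[n l]|].
  - by rewrite /phi /psi /= subrK.
  - by rewrite /phi /psi /= addrK eqxx.
  apply: eq_has_sum hs => -[n l]; rewrite /f /c /phi /euler_coef /=.
  (* Here n stands for the shifted index, and the exponents agree because (n-l)^2 + l(l-1) +
     2l(n-l+1) = n^2 + l. *)
  have key : q ^ ((n - l%:Z) * (n - l%:Z)) * p ^+ 'C(l, 2) * (p ^ (n - l%:Z + 1)) ^+ l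
      = q ^ (n * n) * q ^+ l.
    rewrite /p -exprM !exprnP !exprz_exp -!expfzDr //; congr (_ ^ _).
    have := binZ l; lia.
  have wl : w ^+ l = (-1) ^+ l * q ^+ l / z ^+ l 
    by rewrite -exprVn -!exprMn mulN1r mulNr.
  rewrite expfzDr // -exprnN wl.
  rewrite [RHS](_ : _ = q ^ (n * n) * q ^+ l *
    (z ^ n * (-1) ^+ l / z ^+ l / qpoch p p l)); last by ring.
  by rewrite -key; ring.
have inner n : has_sum (fun l => f (n, l)) (z ^ n * q ^ (n * n) * qpoch_inf (p ^ (n + 1)) p).
  by apply: has_sumZ; case: (has_sum_qpoch_inf (p ^ (n + 1)) p0 p1).
have hZ := has_sum_fubini hf inner.
(* Only n >= 0 contributes: for [Negz n] the exponent n + 1 of the bilateral index becomes -n, and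
   (p^(-n); p)_oo = 0. For n >= 0, n^2 = n(n-1) + n makes the terms those of Euler's series for
   (-zq; p)_oo, times (p; p)_oo. *)
have hN : has_sum (fun n : int => z ^ n * q ^ (n * n) * qpoch_inf (p ^ (n + 1)) p)
    (qpoch_inf p p * qpoch_inf (- (z * q)) p).
  apply: (@has_sum_emb _ _ _ Posz absz) => //.
    case=> [n|n]; first by rewrite absz_nat eqxx.
    move=> _; rewrite [p ^ _](_ : _ = p ^- n); last by rewrite exprnN; congr (_ ^ _); lia.
    by rewrite qpoch_inf_eq0 // mulr0.
  have [h _] := has_sum_qpoch_inf (- (z * q)) p0 p1.
  apply: eq_has_sum (has_sumZ (qpoch_inf p p) h) => k /=.
  rewrite [p ^ _](_ : _ = p * p ^+ k); last by rewrite -exprS exprnP; congr (_ ^ _); lia.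
  rewrite (qpoch_inf_shift p k p0 p1) /euler_coef.
  rewrite [q ^ _](_ : _ = p ^+ 'C(k, 2) * q ^+ k); last first.
    by rewrite /p -exprM -exprD exprnP; congr (_ ^ _); have := binZ k; lia.
  have -> : (- (z * q)) ^+ k = (-1) ^+ k * z ^+ k * q ^+ k by rewrite -!exprMn mulN1r mulNr.
  rewrite -[z ^ k]exprnP [RHS](_ : _ = (-1) ^+ k * (-1) ^+ k * (qpoch p p k / qpoch p p k)
    * (z ^+ k * (p ^+ 'C(k, 2) * q ^+ k) * qpoch_inf (p * p ^+ k) p)); last by ring.
  by rewrite -exprMn mulrNN mulr1 expr1n divff ?qpochqq_neq0 // !mul1r.
have := has_sum_unique hZ hN; rewrite sE => E.
suff -> : qpoch_inf (- (z * q)) p * qpoch_inf w p * qpoch_inf p p = T by [].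
rewrite mulrC mulrA -E divfK //.
exact: qpoch_inf_lt1_neq0.
Qed.

(* The theta series is invariant under z -> 1/z, and |q/z| < 1 or |qz| < 1. *)
Lemma triple_product q z : q != 0 -> `|q| < 1 -> z != 0 ->
  has_sum (fun n : int => z ^ n * q ^ (n * n))
    (qpoch_inf (- (z * q)) (q ^+ 2) * qpoch_inf (- (q / z)) (q ^+ 2)
       * qpoch_inf (q ^+ 2) (q ^+ 2)).
Proof.
move=> q0 q1 z0; have [z1|z1] := real_ltP (normr_real z) (@real1 C).
  have zi0 : z^-1 != 0 by rewrite invr_eq0.
  have := @triple_product_lt q z^-1 q0 q1 zi0.
  rewrite invrK normrM => h.
  have {}h := h (mulr_ilt1 (normr_ge0 _) (normr_ge0 _) q1 z1).
  apply: (@has_sum_emb _ _ _ (fun n : int => - n) (fun n : int => - n)) => [n|n|].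
  - by rewrite opprK.
  - by rewrite opprK eqxx.
  rewrite (mulrC z) [qpoch_inf (- (q * z)) _ * _]mulrC (mulrC q z^-1).
  by apply: eq_has_sum h => n /=; rewrite mulrNN -exprz_inv.
apply: triple_product_lt => //.
rewrite normrM normfV; apply: le_lt_trans q1.
by rewrite ler_pdivrMr ?ler_peMr // (lt_le_trans _ z1).
Qed.

End TripleProduct.

(** * The double sum *)

Lemma norm_exprz (F : numFieldType) (x : F) (n : int) : `|x ^ n| = `|x| ^ n.
Proof.
case: n => n; first by rewrite -!exprnP normrX.
by rewrite !NegzE -!exprnN normfV normrX.
Qed.

Section A2Sum.
Variable R : realType.
Local Notation C := (complex R : numFieldType).

Lemma has_sum_prod (T U : choiceType) (f : T -> C) (g : U -> C) s t :
  abs_summable f -> abs_summable g -> has_sum f s -> has_sum g t ->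
  has_sum (fun p => f p.1 * g p.2) (s * t).
Proof.
move=> Sf Sg fs gt; have [u hu] := summable_has_sum (summable_prod Sf Sg).
have h x : has_sum (fun y => f (x, y).1 * g (x, y).2) (f x * t) by apply: has_sumZ.
have h1 := has_sum_fubini hu h.
have h2 := has_sumZ t fs.
suff -> : s * t = u by [].
by rewrite mulrC; apply: has_sum_unique (eq_has_sum _ h2) h1 => x; rewrite mulrC.
Qed.

Variables (q : C).
Hypotheses (q0 : q != 0) (q1 : `|q| < 1).

(** The (k, l) summand in the coefficient of x^a y^b, where d = b - a, once q^(a^2 - ab + b^2) has
    been taken out. *)
Definition cross_term (d : int) (kl : nat * nat) : C :=
  euler_coef q kl.1 * euler_coef q kl.2
  * q ^ (kl.1%:Z + kl.2%:Z - kl.1%:Z * kl.2%:Z + (kl.1%:Z - kl.2%:Z) * d).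

(* With r^2 = |q| the bounds below have integer exponents: |cross_term d (k, l)|
   is a bounded multiple of r^((d + k - l)^2 - d^2 + k + l). *)
Let r : C := sqrtC `|q|.

Let nq_gt0 : 0 < `|q|. Proof. by rewrite normr_gt0. Qed.

Let r_gt0 : 0 < r. Proof. by rewrite sqrtC_gt0. Qed.

Let r_lt1 : `|r| < 1.
Proof. by rewrite gtr0_norm // -(@expr_lt1 _ 2) ?sqrtCK // ltW. Qed.

Let norm_qz (m : int) : `|q ^ m| = r ^ (2 * m).
Proof. by rewrite norm_exprz -exprz_exp -[r ^ 2](_ : r ^+ 2 = _) // sqrtCK. Qed.

Let r_sqr_le1 (s : int) : r ^ (s * s) <= 1.
Proof.
have -> : r ^ (s * s) = r ^+ (`|s| * `|s|)%N by rewrite exprnP; congr (_ ^ _); lia.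
by rewrite exprn_ile1 ?ltW // -[r]gtr0_norm.
Qed.

(** The square r^((d+k-l)^2) is bounded by 1. The remaining growth r^(-d^2) is constant in (k, l),
    and the quadratic form in (a, b) later outweighs it. *)
Lemma cross_term_bound : exists2 K : C, 0 <= K & forall d k l,
  `|cross_term d (k, l)| <= K * r ^ (- (d * d)) * (r ^+ k * r ^+ l).
Proof.
have [K K0 hK] := qpochqq_inv_bounded q0 q1.
exists (K * K) => [|d k l]; first exact: mulr_ge0.
have r0 : r != 0 by rewrite gt_eqF.
have eE n : `|euler_coef q n| = r ^ (n%:Z * n%:Z - n%:Z) * `|(qpoch q q n)^-1|.
  rewrite /euler_coef !normrM normrX normrN normr1 expr1n mul1r.
  by rewrite [q ^+ _](_ : _ = q ^ 'C(n, 2)) // norm_qz binZ.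
rewrite /cross_term normrM [X in X * _ <= _]normrM !eE norm_qz /=.
set s := d + k%:Z - l%:Z.
rewrite [leLHS](_ : _ = `|(qpoch q q k)^-1| * `|(qpoch q q l)^-1| *
   (r ^ (s * s) * (r ^ (- (d * d)) * (r ^+ k * r ^+ l)))); last first.
  rewrite [X in _ = _ * X](_ : _ = r ^ (k%:Z * k%:Z - k%:Z) * r ^ (l%:Z * l%:Z - l%:Z)
    * r ^ (2 * (k%:Z + l%:Z - k%:Z * l%:Z + (k%:Z - l%:Z) * d))); first by ring.
  by rewrite !exprnP -!expfzDr //; congr (_ ^ _); rewrite /s; ring.
rewrite -[leRHS]mulrA ler_pM ?mulr_ge0 ?exprz_ge0 ?exprn_ge0 ?(ltW r_gt0) //.
  exact: ler_pM.
by rewrite ler_piMl ?r_sqr_le1 // ?mulr_ge0 ?exprz_ge0 ?exprn_ge0 ?(ltW r_gt0).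
Qed.

Lemma summable_rXr : abs_summable (fun kl : nat * nat => r ^+ kl.1 * r ^+ kl.2).
Proof. exact: summable_prod (summable_geometric r_lt1) (summable_geometric r_lt1). Qed.

Lemma has_sum_cross_term_ge0 (d : int) s : 0 <= d -> has_sum (cross_term d) s ->
  s = if d == 0 then qpoch_inf q q else 0.
Proof.
move=> d0 hs.
(* The exponent is affine in l, namely (k + kd) + l(1 - k - d), so the row is Euler's series at
   q^(1-k-d). *)
have h k : has_sum (fun l => cross_term d (k, l))
    (euler_coef q k * q ^ (k%:Z + k%:Z * d) * qpoch_inf (q ^ (1 - k%:Z - d)) q).
  have [hE _] := has_sum_qpoch_inf (q ^ (1 - k%:Z - d)) q0 q1.
  apply: eq_has_sum (has_sumZ _ hE) => l; rewrite /cross_term /=.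
  rewrite [q ^ (_ + (_ - _) * _)](_ : _ = q ^ (k%:Z + k%:Z * d) * (q ^ (1 - k%:Z - d)) ^+ l).
    by ring.
  by rewrite exprnP exprz_exp -expfzDr //; congr (_ ^ _); ring.
have z0 (m : int) : 1 <= m -> qpoch_inf (q ^ (1 - m)) q = 0.
  move=> m1; have -> : q ^ (1 - m) = q ^- `|m - 1|%N by rewrite exprnN; congr (_ ^ _); lia.
  exact: qpoch_inf_eq0.
apply: has_sum_unique (has_sum_fubini hs h) _.
have -> : (if d == 0 then qpoch_inf q q else 0) =
    euler_coef q 0 * q ^ (0%:Z + 0%:Z * d) * qpoch_inf (q ^ (1 - 0%:Z - d)) q.
  rewrite /euler_coef qpoch0 !expr0 mul0r addr0 expr0z divr1 !mul1r subr0.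
  case: eqP => [->|dn0]; first by rewrite subr0 expr1z.
  by rewrite z0 //; lia.
apply: (@has_sum_single _ _ 0%N (fun k : nat => euler_coef q k
  * q ^ (k%:Z + k%:Z * d) * qpoch_inf (q ^ (1 - k%:Z - d)) q)) => k kn0.
by rewrite -addrA -opprD z0 ?mulr0 //; lia.
Qed.

Lemma has_sum_cross_term d :
  has_sum (cross_term d) (if d == 0 then qpoch_inf q q else 0).
Proof.
have S e : abs_summable (cross_term e).
  have [K K0 hK] := cross_term_bound.
  apply: summable_le _ _ summable_rXr; last first.
    move=> [k l]; apply: le_trans (hK e k l) _.
    by rewrite normrM !normrX (gtr0_norm r_gt0).
  by rewrite mulr_ge0 // exprz_ge0 // ltW.
have [s hs] := summable_has_sum (S d).
case: (leP 0 d) => d0; first by rewrite -(has_sum_cross_term_ge0 d0 hs).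
have sw : has_sum (cross_term (- d)) s.
  apply: (@has_sum_emb _ _ _ (fun p : nat * nat => (p.2, p.1)) (fun p => (p.2, p.1))).
  - by case.
  - by case=> k l; rewrite eqxx.
  apply: eq_has_sum hs => -[k l]; rewrite /cross_term /=.
  by rewrite [euler_coef q l * _]mulrC; congr (_ * _ ^ _); ring.
have dn0 : 0 <= - d by lia.
have := has_sum_cross_term_ge0 dn0 sw; rewrite oppr_eq0.
by move=> <-.
Qed.

Variables (x y : C).
Hypotheses (x0 : x != 0) (y0 : y != 0).

(** The (i, j) term times (xq, yq; q)_oo, with both products expanded; the grouping of indices lets
    Fubini sum (k, l) first. *)
Let f (p : (int * int) * (nat * nat)) : C :=
  x ^ p.1.1 * y ^ p.1.2 * q ^ (p.1.1 * p.1.1 - p.1.1 * p.1.2 + p.1.2 * p.1.2)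
  * ((euler_coef q p.2.1 * (x * q ^ (p.1.1 + 1)) ^+ p.2.1)
   * (euler_coef q p.2.2 * (y * q ^ (p.1.2 + 1)) ^+ p.2.2)).

(** The same fourfold family in the indices a = i + k and b = j + l. *)
Let h (p : (int * int) * (nat * nat)) : C :=
  x ^ p.1.1 * y ^ p.1.2 * q ^ (p.1.1 * p.1.1 - p.1.1 * p.1.2 + p.1.2 * p.1.2)
  * cross_term (p.1.2 - p.1.1) p.2.

Let fE (i j : int) (k l : nat) : f ((i, j), (k, l)) = h ((i + k%:Z, j + l%:Z), (k, l)).
Proof.
have key : q ^ (i * i - i * j + j * j) * (q ^ (i + 1)) ^+ k * (q ^ (j + 1)) ^+ l =
  q ^ ((i + k%:Z) * (i + k%:Z) - (i + k%:Z) * (j + l%:Z) + (j + l%:Z) * (j + l%:Z)) *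
  q ^ (k%:Z + l%:Z - k%:Z * l%:Z + (k%:Z - l%:Z) * (j + l%:Z - (i + k%:Z))).
  by rewrite !exprnP !exprz_exp -!expfzDr //; congr (_ ^ _); ring.
rewrite /f /h /cross_term /= [x ^ (i + k%:Z)]expfzDr // [y ^ (j + l%:Z)]expfzDr //.
rewrite -[x ^ k%:Z]exprnP -[y ^ l%:Z]exprnP !exprMn.
set ek := euler_coef q k; set el := euler_coef q l.
rewrite [RHS](_ : _ =
  q ^ ((i + k%:Z) * (i + k%:Z) - (i + k%:Z) * (j + l%:Z) + (j + l%:Z) * (j + l%:Z)) *
  q ^ (k%:Z + l%:Z - k%:Z * l%:Z + (k%:Z - l%:Z) * (j + l%:Z - (i + k%:Z))) *
  (x ^ i * x ^+ k * (y ^ j * y ^+ l) * (ek * el))); last by ring.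
by rewrite -key; ring.
Qed.

Let summable_h : abs_summable h.
Proof.
have [K K0 hK] := cross_term_bound.
have S := summable_prod (summable_prod (summable_gauss (lt0r_neq0 r_gt0) r_lt1 x0)
  (summable_gauss (lt0r_neq0 r_gt0) r_lt1 y0)) summable_rXr.
apply: summable_le K0 _ S => -[[a b] [k l]]; rewrite /h /=.
have r0 : r != 0 by rewrite gt_eqF.
rewrite normrM; apply: le_trans (ler_wpM2l (normr_ge0 _) (hK _ k l)) _.
rewrite !normrM !normrX norm_qz !norm_exprz (gtr0_norm r_gt0).
rewrite [leLHS](_ : _ = K * (`|x| ^ a * `|y| ^ b 
   * (r ^ (2 * (a * a - a * b + b * b)) * r ^ (- ((b - a) * (b - a))))
   * (r ^+ k * r ^+ l))); last by ring.
(* 2(a^2 - ab + b^2) - (b-a)^2 = a^2 + b^2: the loss r^(-d^2) is absorbed, leaving one Gaussian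
   series in a and one in b. *)
have -> : r ^ (2 * (a * a - a * b + b * b)) * r ^ (- ((b - a) * (b - a)))
    = r ^ (a * a) * r ^ (b * b).
  by rewrite -!expfzDr //; congr (_ ^ _); ring.
by rewrite le_eqVlt; apply/orP; left; apply/eqP; ring.
Qed.

Let Theta := qpoch_inf (- (x * y * q)) (q ^+ 2) * qpoch_inf (- (q / (x * y))) (q ^+ 2)
  * qpoch_inf (q ^+ 2) (q ^+ 2).

Let has_sum_h : has_sum h (Theta * qpoch_inf q q).
Proof.
have [s hs] := summable_has_sum summable_h.
have inner (p : int * int) : has_sum (fun u => h (p, u))
    (x ^ p.1 * y ^ p.2 * q ^ (p.1 * p.1 - p.1 * p.2 + p.2 * p.2)
      * (if p.2 - p.1 == 0 then qpoch_inf q q else 0)).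
  by apply: has_sumZ; apply: has_sum_cross_term.
have h1 := has_sum_fubini hs inner.
suff -> : Theta * qpoch_inf q q = s by [].
apply: has_sum_unique _ h1.
(* Only the diagonal a = b = n survives, where the form equals n^2 and the sum is the theta series
   at z = xy. *)
apply: (@has_sum_emb _ _ _ (fun n : int => (n, n)) fst) => //.
  move=> [a b] /=; rewrite subr_eq0 xpair_eqE eqxx /= eq_sym => /negPf ->.
  by rewrite mulr0.
have T := has_sumZ (qpoch_inf q q) (triple_product q0 q1 (mulf_neq0 x0 y0)).
rewrite mulrC; apply: eq_has_sum T => n /=.
by rewrite subrK [n - n]subrr eqxx expfzMl; ring.
Qed.

Let has_sum_f : has_sum f (Theta * qpoch_inf q q).
Proof.
apply: (@has_sum_emb _ _ _
  (fun p : (int * int) * (nat * nat) => ((p.1.1 - p.2.1%:Z, p.1.2 - p.2.2%:Z), p.2))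
  (fun p : (int * int) * (nat * nat) => ((p.1.1 + p.2.1%:Z, p.1.2 + p.2.2%:Z), p.2))).
- by move=> [[a b] [k l]]; rewrite /= !subrK.
- by move=> [[a b] [k l]]; rewrite /= !addrK eqxx.
by apply: eq_has_sum has_sum_h => -[[a b] [k l]]; rewrite /= fE !subrK.
Qed.

Let summable_f : abs_summable f.
Proof.
have phiI : injective (fun p : (int * int) * (nat * nat) =>
    ((p.1.1 + p.2.1%:Z, p.1.2 + p.2.2%:Z), p.2)).
  move=> [[a b] [k l]] [[a' b'] [k' l']] /= [e1 e2 e3 e4]; subst k' l'.
  by rewrite (addIr _ e1) (addIr _ e2).
rewrite (_ : f = h \o (fun p : (int * int) * (nat * nat) =>
    ((p.1.1 + p.2.1%:Z, p.1.2 + p.2.2%:Z), p.2))); first exact: (summable_comp phiI summable_h).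
by apply/funext => -[[a b] [k l]]; rewrite fE.
Qed.

Let g (p : int * int) : C := x ^ p.1 * y ^ p.2 * q ^ (p.1 * p.1 - p.1 * p.2 + p.2 * p.2)
  * (qpoch_inf (x * q ^ (p.1 + 1)) q * qpoch_inf (y * q ^ (p.2 + 1)) q).

(** Summing [f] over (k, l) at fixed (i, j) folds the two Euler series back into infinite products,
    while the total is known from the indices a, b. *)
Lemma has_sum_A2 : has_sum g (Theta * qpoch_inf q q) /\ abs_summable g.
Proof.
have inner p : has_sum (fun u => f (p, u)) (g p).
  apply: has_sumZ.
  apply: (@has_sum_prod _ _ (fun k => euler_coef q k * (x * q ^ (p.1 + 1)) ^+ k)
           (fun l => euler_coef q l * (y * q ^ (p.2 + 1)) ^+ l)).
  - exact: summable_euler.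
  - exact: summable_euler.
  - by case: (has_sum_qpoch_inf (x * q ^ (p.1 + 1)) q0 q1).
  - by case: (has_sum_qpoch_inf (y * q ^ (p.2 + 1)) q0 q1).
split; first exact: has_sum_fubini has_sum_f inner.
exact: summable_fubini summable_f inner.
Qed.

End A2Sum.

(** * From unconditional sums to square partial sums, with q = 0 treated apart *)

Theorem theorem1p1 (R : realType) (q x y : R[i])
  (hq : `|q| < 1) (hx : x != 0) (hy : y != 0)
  (hxk : forall k : nat, (1 <= k)%N -> x * q ^+ k != 1)
  (hyk : forall k : nat, (1 <= k)%N -> y * q ^+ k != 1) :
  cvgn (sqsum (fun i j => `|term1p1 x y q i j|)) /\
  (sqsum (term1p1 x y q) @ \oo -->
    qpoch_inf q q * qpoch_inf (- (x * y * q)) (q ^+ 2)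
      * qpoch_inf (- (q / (x * y))) (q ^+ 2) * qpoch_inf (q ^+ 2) (q ^+ 2)
    / (qpoch_inf (x * q) q * qpoch_inf (y * q) q)).
Proof.
suff [S h] : abs_summable (fun p => term1p1 x y q p.1 p.2) /\
    has_sum (fun p => term1p1 x y q p.1 p.2)
    (qpoch_inf q q * qpoch_inf (- (x * y * q)) (q ^+ 2)
      * qpoch_inf (- (q / (x * y))) (q ^+ 2) * qpoch_inf (q ^+ 2) (q ^+ 2)
    / (qpoch_inf (x * q) q * qpoch_inf (y * q) q)).
  split; last exact: has_sum_sqsum.
  have Sn : abs_summable (fun p => `|term1p1 x y q p.1 p.2|).
    by apply: (summable_le ler01) S => p; rewrite mul1r normr_id.
  have [s hs] := summable_has_sum Sn.
  by apply/cvg_ex; exists s; apply: has_sum_sqsum.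
(* At q = 0 the negative powers of q lose their meaning, but a nonzero power of 0 is 0 and i^2 - ij
   + j^2 vanishes only at the origin. The sum reduces to its (0, 0) term 1, and every product on the
   right is [qpoch_inf 0 0]. *)
have [q0|q0] := eqVneq q 0.
  have t0 (p : int * int) : p != (0, 0) -> term1p1 x y q p.1 p.2 = 0.
    case: p => a b; rewrite xpair_eqE negb_and => ab0.
    rewrite /term1p1 q0 exp0rz /= [_ == 0](_ : _ = false) ?mulr0 ?mul0r //.
    by apply/negbTE/eqP => h; move: ab0; have [-> ->] : a = 0 /\ b = 0 by nia.
  have t1 : term1p1 x y q 0 0 = 1.
    
    rewrite /term1p1 (_ : 0 * 0 - 0 * 0 + 0 * 0 = 0 :> int) // !expr0z /=.
    by rewrite !qpoch0 !mulr1 divr1.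
  split.
    exists 1 => A; case: (boolP ((0, 0) \in A)) => hA.
      rewrite (big_fsetD1 (0, 0)) //= t1 normr1 big1_seq ?addr0 // => p /=.
      by rewrite !inE => /andP[/t0 ->]; rewrite normr0.
    rewrite big1_seq // => p /= pA; rewrite t0 ?normr0 //.
    by apply: contraNneq hA => <-.
  have i0 : qpoch_inf 0 0 = 1 :> R[i].
    rewrite /qpoch_inf (_ : qpoch 0 0 = fun=> 1) ?lim_cst //.
    by apply/funext => n; rewrite /qpoch big1 // => k _; rewrite mul0r subr0.
  have h := @has_sum_single _ _ (0, 0) (fun p => term1p1 x y q p.1 p.2) t0.
  rewrite t1 in h.
  rewrite [X in has_sum _ X](_ : _ = 1); first exact: h.
  by rewrite q0 expr0n /= !(mulr0, mul0r, oppr0) i0 !mulr1 divr1.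
have xq k : x * q * q ^+ k != 1 by rewrite -mulrA -exprS hxk.
have yq k : y * q * q ^+ k != 1 by rewrite -mulrA -exprS hyk.
have [hs S] := has_sum_A2 q0 hq hx hy.
set c := qpoch_inf (x * q) q * qpoch_inf (y * q) q.
have c0 : c != 0 by rewrite mulf_neq0 ?qpoch_inf_neq0.
(* Dividing by the nonzero constant c = (xq, yq; q)_oo recovers the original terms from those of
   [has_sum_A2]. *)
have tE p : term1p1 x y q p.1 p.2 = c^-1 *
  (x ^ p.1 * y ^ p.2 * q ^ (p.1 * p.1 - p.1 * p.2 + p.2 * p.2)
  * (qpoch_inf (x * q ^ (p.1 + 1)) q * qpoch_inf (y * q ^ (p.2 + 1)) q)).
  rewrite (qpoch_inf_qpochZ _ q0 hq xq) (qpoch_inf_qpochZ _ q0 hq yq).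
  rewrite [_ / _ * (_ / _)]mulrACA -/c.
  by rewrite mulrC -[RHS]mulrA; congr (_ * _); rewrite mulrAC divff // mul1r invfM.
split.
  apply: summable_le (normr_ge0 c^-1) _ S => p.
  by rewrite tE normrM.
have := eq_has_sum tE (has_sumZ c^-1 hs).
by rewrite [c^-1 * _]mulrC [_ * qpoch_inf q q]mulrC !mulrA.
Qed.
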